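(* Let $\mathcal{A}$ be a randomized algorithm taking as an input an $n$-element dataset (an element of $\mathcal{X}^n$) and outputting a value in a finite set $\mathcal{Y}$. Then for every $\beta>0$, $I_\infty^\beta(\mathcal{A},n)\le\log(|\mathcal{Y}|/\beta)$.
   Context: All random variables take values in finite domains; $\log$ is the binary logarithm. For jointly distributed random variables $\boldsymbol{X},\boldsymbol{Y}$, $\boldsymbol{X}\times\boldsymbol{Y}$ denotes the random variable obtained by drawing $\boldsymbol{X}$ and $\boldsymbol{Y}$ independently from their marginal distributions. For random variables $\boldsymbol{U},\boldsymbol{V}$ over the same domain $\mathcal{D}$, $$D_\infty^\delta(\boldsymbol{U}\|\boldsymbol{V})=\log\max_{\mathcal{O}\subseteq\mathcal{D},\ \Pr[\boldsymbol{U}\in\mathcal{O}]>\delta}\frac{\Pr[\boldsymbol{U}\in\mathcal{O}]-\delta}{\Pr[\boldsymbol{V}\in\mathcal{O}]},$$ and $I_\infty^\beta(\boldsymbol{X};\boldsymbol{Y})=D_\infty^\beta((\boldsymbol{X},\boldsymbol{Y})\|\boldsymbol{X}\times\boldsymbol{Y})$. For an algorithm $\mathcal{A}$ on $\mathcal{X}^n$, $I_\infty^\beta(\mathcal{A},n)\le k$ means that for every distribution $\mathcal{S}$ over $\mathcal{X}^n$ and $\boldsymbol{S}$ chosen randomly according to $\mathcal{S}$, $I_\infty^\beta(\boldsymbol{S};\mathcal{A}(\boldsymbol{S}))\le k$. *)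

(* Defs.v *)
From HB Require Import structures.
From mathcomp Require Import all_boot all_order all_algebra.
From mathcomp Require Import all_classical all_reals all_analysis.

Set Implicit Arguments.
Unset Strict Implicit.
Unset Printing Implicit Defensive.

Import Order.TTheory GRing.Theory Num.Theory.

Local Open Scope ring_scope.

(* Random variables have finite domains and enter only through their laws:
   a (joint) random variable is represented by its (joint) distribution. *)
Record fdist (R : realType) (T : finType) := FDist {
  fdist_val :> {ffun T -> R};
  fdist_ge0 : forall x, 0 <= fdist_val x;
  fdist_sum1 : \sum_x fdist_val x = 1
}.

Section Distributions.
Context {R : realType}.

Definition Pr (T : finType) (P : fdist R T) (O : {set T}) : R :=
  \sum_(x in O) P x.

Section Marginals.
Variables (T U : finType) (P : fdist R (T * U)%type).

Definition marg1_val : {ffun T -> R} := [ffun x => \sum_y P (x, y)].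

Lemma marg1_ge0 x : 0 <= marg1_val x.
Proof. by rewrite ffunE sumr_ge0// => y _; exact: fdist_ge0. Qed.

Lemma marg1_sum1 : \sum_x marg1_val x = 1.
Proof.
under eq_bigr do rewrite ffunE.
by rewrite pair_big/= -[RHS](fdist_sum1 P); apply: eq_bigr => -[].
Qed.

Definition marg1 : fdist R T := FDist marg1_ge0 marg1_sum1.

Definition marg2_val : {ffun U -> R} := [ffun y => \sum_x P (x, y)].

Lemma marg2_ge0 y : 0 <= marg2_val y.
Proof. by rewrite ffunE sumr_ge0// => x _; exact: fdist_ge0. Qed.

Lemma marg2_sum1 : \sum_y marg2_val y = 1.
Proof.
under eq_bigr do rewrite ffunE.
by rewrite exchange_big pair_big/= -[RHS](fdist_sum1 P); apply: eq_bigr => -[].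
Qed.

Definition marg2 : fdist R U := FDist marg2_ge0 marg2_sum1.

End Marginals.

(* Law of (S, A(S)), where S has law [S] and, given S = s, A(s) has law
   [A s]. *)
Section Joint.
Variables (T U : finType) (S : fdist R T) (A : T -> fdist R U).

Definition joint_val : {ffun T * U -> R} := [ffun z => S z.1 * A z.1 z.2].

Lemma joint_ge0 z : 0 <= joint_val z.
Proof. by rewrite ffunE mulr_ge0// fdist_ge0. Qed.

Lemma joint_sum1 : \sum_z joint_val z = 1.
Proof.
under eq_bigr do rewrite ffunE.
rewrite -(pair_bigA _ (fun x y => S x * A x y))/= -[RHS](fdist_sum1 S).
by apply: eq_bigr => x _; rewrite -mulr_sumr fdist_sum1 mulr1.
Qed.

Definition joint : fdist R (T * U)%type := FDist joint_ge0 joint_sum1.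

End Joint.

(* Law of X x Y when (X, Y) has law [P]. *)
Definition indep_prod (T U : finType) (P : fdist R (T * U)%type) :
  fdist R (T * U)%type := joint (marg1 P) (fun=> marg2 P).

Local Open Scope ereal_scope.

(* Binary logarithm on the extended reals: log2e 0 = -oo, log2e +oo = +oo. *)
Definition log2e (x : \bar R) : \bar R := lne x / (ln 2)%:E.

(* Division in \bar R gives r / 0 = +oo for r > 0, so the value is +oo when an
   admissible event is null under [V].  If no event is admissible (delta >= 1),
   the maximum is -oo and so is its logarithm. *)
Definition approx_max_div (T : finType) (delta : R) (U V : fdist R T) :
    \bar R :=
  log2e (\big[maxe/-oo]_(O : {set T} | (delta < Pr U O)%R)
    ((Pr U O - delta)%:E / (Pr V O)%:E)).

Definition approx_max_info (T U : finType) (beta : R)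
    (P : fdist R (T * U)%type) : \bar R :=
  approx_max_div beta P (indep_prod P).

(* A randomized algorithm on X^n maps a dataset to the law of its output. *)
Definition alg_max_info_le (X Y : finType) (n : nat) (beta : R)
    (A : n.-tuple X -> fdist R Y) (k : \bar R) : Prop :=
  forall S : fdist R (n.-tuple X), approx_max_info beta (joint S A) <= k.

End Distributions.

(* Main.v *)
Require Import Defs.
From mathcomp Require Import all_boot all_order all_algebra.
From mathcomp Require Import all_classical all_reals all_analysis.

Import Order.TTheory GRing.Theory Num.Theory.

Local Open Scope ring_scope.

(** Call an output [y] light if its marginal probability is below
    [c = beta / #|Y|]. Light outputs carry total mass at most [c * #|Y| = beta],
    whereas if [y] is not light then
    [P (x, y) <= P_1 x <= c^-1 * (P_1 x * P_2 y)]. Summing over an event [O]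
    gives [P(O) - beta <= (#|Y| / beta) * (P_1 x P_2)(O)]. *)

Lemma log2e_ndecr {R : realType} (x y : \bar R) :
  (x <= y)%E -> (log2e x <= log2e y)%E.
Proof.
move=> xy; rewrite /log2e; apply: lee_wpmul2r.
  by rewrite inver gt_eqF ?ln_gt0 ?ltr1n// lee_fin invr_ge0 ltW// ln_gt0 ?ltr1n.
(* [lne] is [-oo] at every nonpositive argument, so only positive [x] requires the monotonicity of
   the logarithm. *)
have [x0|x0] := leP x 0%E; first by rewrite le0_lneNy// leNye.
by rewrite lee_lne// in_itv/= leey andbT ltW// (lt_le_trans x0).
Qed.

Lemma fdist_le_marg1 {R : realType} {T U : finType} (P : fdist R (T * U)%type)
  x y : P (x, y) <= marg1 P x.
Proof.
by rewrite ffunE (bigD1 y)//= lerDl sumr_ge0// => z _; exact: fdist_ge0.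
Qed.

Lemma indep_prodE {R : realType} {T U : finType} (P : fdist R (T * U)%type)
  x y : indep_prod P (x, y) = marg1 P x * marg2 P y.
Proof. by rewrite ffunE. Qed.

Lemma card_fdist_gt0 {R : realType} {T : finType} (P : fdist R T) :
  (0 < #|T|)%N.
Proof.
rewrite lt0n; apply/eqP => T0; have := fdist_sum1 P.
rewrite big_pred0 => [/esym/eqP|x]; first by rewrite oner_eq0.
by have := card0_eq T0 x; rewrite !inE.
Qed.

Lemma fdist_le_indep_prod {R : realType} {T U : finType}
    (P : fdist R (T * U)%type) {c : R} z : 0 < c ->
  P z <= c^-1 * indep_prod P z + (if marg2 P z.2 < c then P z else 0).
Proof.
case: z => x y c0; rewrite /= indep_prodE; case: ltP => yc.
  by rewrite lerDr mulr_ge0 ?invr_ge0 ?(ltW c0)// mulr_ge0 ?fdist_ge0.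
rewrite addr0 (le_trans (fdist_le_marg1 P x y))//.
(* As [y] is not light, the factor [c^-1 * marg2 P y] is at least 1. *)
by rewrite mulrCA ler_peMr ?fdist_ge0// mulrC ler_pdivlMr// mul1r.
Qed.

(** Enlarging [O] to the whole space only adds nonnegative terms. Summing over the first coordinate
    then leaves at most [c] for each [y]: its marginal if [y] is light, 0 otherwise. *)
Lemma light_mass_le {R : realType} {T U : finType}
    (P : fdist R (T * U)%type) {c : R} (O : {set T * U}) : 0 <= c ->
  \sum_(z in O) (if marg2 P z.2 < c then P z else 0) <= c * #|U|%:R.
Proof.
move=> c0; set F := fun x y => if marg2 P y < c then P (x, y) else 0.
have F0 z : 0 <= (if marg2 P z.2 < c then P z else 0).
  by case: ifP => // _; exact: fdist_ge0.
apply: (@le_trans _ _ (\sum_z (if marg2 P z.2 < c then P z else 0))).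
  by rewrite [leRHS](bigID (mem O))/= lerDl sumr_ge0.
rewrite (eq_bigr (fun z => F z.1 z.2)) => [|[]//].
rewrite -(pair_bigA _ F)/= exchange_big/= mulr_natr -sumr_const.
apply: ler_sum => y _; rewrite /F; case: ltP => [yc|_]; last by rewrite big1.
by move: yc; rewrite ffunE => /ltW.
Qed.

Lemma Pr_le_indep_prod {R : realType} {T U : finType}
    (P : fdist R (T * U)%type) {c : R} (O : {set T * U}) : 0 < c ->
  Pr P O <= c^-1 * Pr (indep_prod P) O + c * #|U|%:R.
Proof.
move=> c0; apply: le_trans (lerD (lexx _) (light_mass_le P O (ltW c0))).
rewrite /Pr mulr_sumr -big_split/=.
by apply: ler_sum => z _; exact: fdist_le_indep_prod.
Qed.

Lemma Pr_sub_le_indep_prod {R : realType} {T U : finType}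
    (P : fdist R (T * U)%type) {beta : R} (O : {set T * U}) : 0 < beta ->
  Pr P O - beta <= #|U|%:R / beta * Pr (indep_prod P) O.
Proof.
move=> b0.
have U0 : 0 < #|U|%:R :> R by rewrite ltr0n (card_fdist_gt0 (marg2 P)).
rewrite lerBlDr -invf_div.
(* The threshold [beta / #|U|] makes the additive error exactly [beta]. *)
have := Pr_le_indep_prod P O (divr_gt0 b0 U0).
by rewrite divfK ?gt_eqF.
Qed.

Lemma approx_max_info_le {R : realType} {T U : finType}
    (P : fdist R (T * U)%type) {beta : R} : 0 < beta ->
  (approx_max_info beta P <= log2e (#|U|%:R / beta)%:E)%E.
Proof.
move=> b0; apply: log2e_ndecr.
(* Bounding each quotient suffices; the base case [-oo] also covers the absence of admissible
   events. *)
apply: (big_ind (fun x => x <= (#|U|%:R / beta)%:E)%E).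
- exact: leNye.
- by move=> x y xk yk; rewrite ge_max xk yk.
move=> O bO; have PO := Pr_sub_le_indep_prod P O b0.
(* An admissible event is not null under the product of the marginals, so the
   quotient is not the junk value [r / 0 = +oo]. *)
have V0 : 0 < Pr (indep_prod P) O.
  have := lt_le_trans (_ : 0 < Pr P O - beta) PO.
  rewrite subr_gt0 => /(_ bO); apply: contraTT; rewrite -!leNgt => V0.
  by rewrite mulr_ge0_le0// divr_ge0// ltW.
by rewrite inver gt_eqF// -EFinM lee_fin ler_pdivrMr.
Qed.

Theorem theorem17 (R : realType) (X Y : finType) (n : nat)
    (A : n.-tuple X -> fdist R Y) (beta : R) (hbeta : 0 < beta) :
  alg_max_info_le beta A (log2e (#|Y|%:R / beta)%:E).
Proof. by move=> S; exact: approx_max_info_le. Qed.
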